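(* The steering word $T=(t_n)_{n\ge0}$ of $(3/2)^n$ is not eventually periodic; that is, there are no $N\in\mathbb{N}$ and $p\ge1$ with $t_{n+p}=t_n$ for all $n\ge N$.
   Context: For $n\in\mathbb{N}=\{0,1,2,\dots\}$ let $m_n\in\mathbb{Z}$ be the nearest integer to $(3/2)^n$, with half-integers rounded up, so that $(3/2)^n-m_n\in[-\tfrac12,\tfrac12)$. The steering letter is $t_n=2m_{n+1}-3m_n\in\{-2,-1,0,1,2\}$, and the steering word is the infinite word $T=(t_n)_{n\ge0}$. *)

(* Defs.v *)
From mathcomp Require Import all_boot all_order all_algebra.

Set Implicit Arguments.
Unset Strict Implicit.
Unset Printing Implicit Defensive.

Import Order.TTheory GRing.Theory Num.Theory.
Local Open Scope ring_scope.

(* Adding 1/2 before taking the floor rounds half-integers up. *)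
Definition nearest_int (x : rat) : int := Num.floor (x + 1 / 2%:R).

Definition nearest_pow (n : nat) : int := nearest_int ((3%:R / 2%:R) ^+ n).

Definition steering_letter (n : nat) : int :=
  2 * nearest_pow n.+1 - 3 * nearest_pow n.

(* Infinite words over A are functions nat -> A. *)
Definition eventually_periodic (A : Type) (w : nat -> A) : Prop :=
  exists N p : nat,
    (1 <= p)%N /\ forall n : nat, (N <= n)%N -> w (n + p)%N = w n.

(* Main.v *)
Require Import Defs.
From mathcomp Require Import all_boot all_order all_algebra.
From mathcomp Require Import lra zify.

(** If [t_(n+p) = t_n] for all [n >= N], the integers [D_n = m_(n+p) - m_n]
    satisfy [2 D_(n+1) = 3 D_n] for [n >= N], so [D_N] is divisible by every
    power of 2 and hence all these [D_n] vanish.  But [m] is strictly increasing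
    from [n = 2] on, because consecutive powers of 3/2 then differ by at
    least 1. *)

Import Order.TTheory GRing.Theory Num.Theory.
Local Open Scope ring_scope.

(** The exponent [k = |z|] is enough: as 2 and 3 are coprime, [2 ^ |z|] divides [|z|], yet
    [|z| < 2 ^ |z|]. *)
Lemma dvdz_all_pow2_eq0 (z : int) :
  (forall k, exists w : int, 2 ^+ k * w = 3 ^+ k * z) -> z = 0.
Proof.
move=> zP; apply/eqP; rewrite -absz_eq0; apply/negPn/negP; rewrite -lt0n => z_gt0.
have [w /(congr1 absz)] := zP `|z|%N.
rewrite !abszM !abszX /= => zE.
have: (2 ^ `|z| %| 3 ^ `|z| * `|z|)%N by rewrite -zE dvdn_mulr.
rewrite Gauss_dvdr; last by rewrite coprimeXl // coprimeXr.
by move/(dvdn_leq z_gt0); rewrite leqNgt ltn_expl.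
Qed.

Lemma nearest_pow_ltS (n : nat) : (2 <= n)%N -> nearest_pow n < nearest_pow n.+1.
Proof.
move=> n_ge2; rewrite /nearest_pow /nearest_int.
(* The next power exceeds [x] by [x / 2], so [x >= 2] is what is needed; [(3/2)^2 = 9/4]
   suffices. *)
have x_ge2 : 2 <= (3%:R / 2%:R : rat) ^+ n.
  apply: (@le_trans _ _ ((3%:R / 2%:R) ^+ 2)) => //.
  by rewrite ler_weXn2l.
rewrite exprS; set x := (_ ^+ n) in x_ge2 *.
rewrite -lezD1 floor_ge_int intrD.
have := floor_le (x + 1 / 2%:R); lra.
Qed.

Lemma nearest_pow_lt (n p : nat) :
  (2 <= n)%N -> (1 <= p)%N -> nearest_pow n < nearest_pow (n + p).
Proof.
move=> n_ge2; case: p => // p _; elim: p => [|p IHp].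
  by rewrite addn1 nearest_pow_ltS.
by apply: (lt_trans IHp); rewrite [(n + p.+2)%N]addnS nearest_pow_ltS // ltn_addr.
Qed.

Theorem theorem2p9 : ~ eventually_periodic steering_letter.
Proof.
move=> [N [p [p_gt0 tP]]].
pose D k := nearest_pow (N + k + p) - nearest_pow (N + k).
have DS k : 2 * D k.+1 = 3 * D k.
  have := tP (N + k)%N (leq_addr _ _).
  rewrite /steering_letter /D addnS addSn; lia.
have DX k : 2 ^+ k * D k = 3 ^+ k * D 0%N.
  elim: k => [|k IHk]; first by rewrite !expr0.
  by rewrite exprSr -mulrA DS mulrCA IHk mulrA -exprS.
have D0 : D 0%N = 0 by apply: dvdz_all_pow2_eq0 => k; exists (D k).
(* Index 2 ensures [N + 2 >= 2] even for small [N]; strict growth fails earlier, as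
   [m_1 = m_2 = 2]. *)
have D2 : D 2%N = 0 by have := DX 2%N; rewrite D0; lia.
have := @nearest_pow_lt (N + 2) p (leq_addl _ _) p_gt0.
by rewrite -subr_gt0 -/(D 2%N) D2 ltxx.
Qed.
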